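(* For every sequence $\xi_1,\xi_2,\xi_3,\dots$ of distinct irrational (real) numbers and every sequence $c_1,c_2,c_3,\dots$ of positive real numbers there is a bijection $\varphi:\mathbb{N}\to\mathbb{Q}$ such that, for every $k\in\mathbb{N}$, the function $G_\varphi$ is differentiable at $\xi_k$ and $G_\varphi'(\xi_k)=c_k$.
   Context: $\mathbb{N}=\{1,2,3,\dots\}$. For a bijection $\varphi:\mathbb{N}\to\mathbb{Q}$, the function $G_\varphi:\mathbb{R}\to\mathbb{R}$ is defined by $$G_\varphi(x)=\sum_{\varphi(n)<x}\frac{1}{n^2},$$ where the summation is extended over all $n\in\mathbb{N}$ with $\varphi(n)<x$. Differentiable means differentiable with a finite derivative. *)

(* Defs.v *)
From mathcomp Require Import all_boot all_order all_algebra.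
From mathcomp Require Import all_classical all_reals all_analysis.

Set Implicit Arguments.
Unset Strict Implicit.
Unset Printing Implicit Defensive.

Import Order.TTheory GRing.Theory Num.Theory.
Import numFieldNormedType.Exports.

Local Open Scope classical_set_scope.
Local Open Scope ring_scope.

(* The index set {1, 2, 3, ...}; sequences over it are functions on nat whose
   value at 0 is never used. *)
Definition posnats : set nat := [set n | (0 < n)%N].

(* The sum of 1 / n^2 over all n >= 1 with phi n < x, as the limit of its
   partial sums; the terms are nonnegative and dominated by 1 / n^2, so the
   limit exists and does not depend on the order of summation. *)
Definition G (R : realType) (phi : nat -> rat) (x : R) : R :=
  limn (fun m : nat => \sum_(1 <= n < m | ratr (phi n) < x) (1 / n%:R ^+ 2 : R)).

(* Main.v *)
Require Import Defs.
From mathcomp Require Import all_boot all_order all_algebra.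
From mathcomp Require Import all_classical all_reals all_analysis.
From mathcomp Require Import ring lra zify.
Import Order.TTheory GRing.Theory Num.Theory.
Import numFieldNormedType.Exports.
Local Open Scope classical_set_scope.
Local Open Scope ring_scope.

(** Write mu for the measure with an atom of weight 1 / n^2 at each phi n, so
that G phi is its distribution function. What is needed is that, for each k,
the mass of mu within distance h of xi_k, on either side, is
c_k h + O(h^2) as h tends to 0.

The model near one point and on one side uses the integers n = 2^i (2 m + 1)
with i fixed, that is, those with [logn 2 n = i]. They form an arithmetic
progression of step p = 2^(i+1), so the sum of their weights over n >= U is
1 / (p U) + O(1 / U^2). With B = 1 / (p c), placing n anywhere at a distance
between B / (n + p) and B / n from xi therefore gives the mass c h + O(h^2)
within distance h: the integers used are those beyond U = B / h, up to one
step of the progression. The values i = 2 k and i = 2 k + 1 serve the right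
and the left side of xi_k, for every k at once ([shell]).

All other integers, and all other rationals, are paired so that they do not
disturb this. If 1 <= (phi n - xi_j)^2 n ([far]), then n can lie within h of
xi_j only when n >= 1 / h^2, and all such n together weigh O(h^2). So it
suffices that, for every j, all but finitely many n outside the shells of
xi_j satisfy [far] at j. The relation [admissible] between n and a rational q
guarantees this ([admissible_dichotomy]), and it is loose enough for a
back-and-forth argument ([back_and_forth]): every n is admissible with
infinitely many q, because it may go into its shell or far out on the real
line, and every q is admissible with every large odd n, because q differs
from all the xi_j. The resulting bijection is phi; [one_sided_mass] gives the
mass estimate and [linear_mass_derive] turns it into a derivative. *)

(** * Back-and-forth matchings *)

(** The relation [r] is exhausted by finite partial matchings, stage n.+1
putting n on the left and the element coded by n on the right. *)
Lemma back_and_forth (T : countType) (r : nat -> T -> Prop)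
    (r_left : forall n (s : seq T), exists2 x, x \notin s & r n x)
    (r_right : forall x (s : seq nat), exists2 n, n \notin s & r n x) :
  exists f : nat -> T,
    [/\ injective f, forall x, exists n, f n = x & forall n, r n (f n)].
Proof.
pose matching (s : seq (nat * T)) :=
  [/\ {in s &, forall u v, u.1 = v.1 -> u = v},
      {in s &, forall u v, u.2 = v.2 -> u = v} &
      {in s, forall u, r u.1 u.2}].
have add_pair n x s : matching s -> n \notin map fst s -> x \notin map snd s ->
    r n x -> matching ((n, x) :: s).
  move=> [s1 s2 sr] ns xs rnx; split.
  - move=> u v; rewrite !inE => /orP[/eqP-> | us] /orP[/eqP-> | vs] //= e.
    + by rewrite e map_f in ns.
    + by rewrite -e map_f in ns.
    + exact: s1.
  - move=> u v; rewrite !inE => /orP[/eqP-> | us] /orP[/eqP-> | vs] //= e.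
    + by rewrite e map_f in xs.
    + by rewrite -e map_f in xs.
    + exact: s2.
  - by move=> u; rewrite inE => /orP[/eqP-> // | /sr].
have add_left n s : matching s ->
    exists s', [/\ matching s', {subset s <= s'} & n \in map fst s'].
  move=> ms; have [ns | ns] := boolP (n \in map fst s); first by exists s; split.
  have [x xs rnx] := r_left n (map snd s).
  exists ((n, x) :: s); split; [exact: add_pair | | by rewrite inE eqxx].
  by move=> u us; rewrite inE us orbT.
have add_right x s : matching s ->
    exists s', [/\ matching s', {subset s <= s'} & x \in map snd s'].
  move=> ms; have [xs | xs] := boolP (x \in map snd s); first by exists s; split.
  have [n ns rnx] := r_right x (map fst s).
  exists ((n, x) :: s); split; [exact: add_pair | | by rewrite inE eqxx].
  by move=> u us; rewrite inE us orbT.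
have step n s : matching s -> exists s', [/\ matching s', {subset s <= s'},
    n \in map fst s' & forall x, unpickle n = Some x -> x \in map snd s'].
  move=> /(add_left n)[s' [ms' ss' ns']].
  case: (unpickle n) => [x|]; last by exists s'; split.
  have [s'' [ms'' ss'' xs'']] := add_right x s' ms'.
  exists s''; split=> //; first by move=> u /ss' /ss''.
    by have /mapP[u us ->] := ns'; rewrite map_f ?ss''.
  by move=> _ [<-].
have /choice[next nextP] (a : nat * seq (nat * T)) : exists s',
    matching a.2 -> [/\ matching s', {subset a.2 <= s'},
    a.1 \in map fst s' & forall x, unpickle a.1 = Some x -> x \in map snd s'].
  have [/(step a.1)[s' ms'] | nm] := pselect (matching a.2); first by exists s'.
  by exists [::] => /nm.
pose fix stage n := if n is m.+1 then next (m, stage m) else [::].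
have stageP n : matching (stage n).
  by elim: n => [|n IHn] //=; have [] := nextP (n, stage n) IHn.
have stageS n := nextP (n, stage n) (stageP n).
have stage_mono m n : (m <= n)%N -> {subset stage m <= stage n}.
  move=> /subnK <-; elim: (n - m)%N => // k IHk u /IHk us.
  by have [_ + _ _] := stageS (k + m)%N; apply.
have common u v m n : u \in stage m -> v \in stage n ->
    u \in stage (maxn m n) /\ v \in stage (maxn m n).
  by move=> um vn; split; [apply: (stage_mono m) | apply: (stage_mono n)];
     rewrite ?leq_maxl ?leq_maxr.
have /choice[f fP] n : exists x, (n, x) \in stage n.+1.
  by have [_ _ /mapP[[n' x] us /= e] _] := stageS n; exists x; rewrite {1}e.
exists f; split.
- move=> m n e; have [um un] := common _ _ _ _ (fP m) (fP n).
  by have [_ /(_ _ _ um un e)[]] := stageP (maxn m.+1 n.+1).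
- move=> x; have [_ _ _ /(_ x)] := stageS (pickle x).
  rewrite /= pickleK => /(_ erefl) /mapP[[n y] un /= e].
  have {e}un : (n, x) \in stage (pickle x).+1 by rewrite [in (n, x)]e.
  exists n; have [vm vn] := common _ _ _ _ (fP n) un.
  by have [/(_ _ _ vm vn erefl)[]] := stageP (maxn n.+1 (pickle x).+1).
- by move=> n; have [_ _ /(_ _ (fP n))] := stageP n.+1.
Qed.

(** * Sums of inverse squares along an arithmetic progression *)

Lemma sum_arithmetic_progression (V : zmodType) (F : nat -> V) (p a K : nat) :
  (a < p)%N ->
  \sum_(0 <= n < p * K | (n %% p == a)%N) F n = \sum_(0 <= j < K) F (a + p * j)%N.
Proof.
move=> ap; elim: K => [|K IHK]; first by rewrite muln0 !big_geq.
rewrite mulnS addnC (big_cat_nat (n := (p * K)%N)) //= ?leq_addr // IHK.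
rewrite big_nat_recr //=; congr (_ + _).
rewrite -{1}[(p * K)%N]add0n big_addn addKn.
rewrite big_nat_cond (eq_bigl (fun n => (0 <= n < p)%N && (n == a))) => [|n].
  by rewrite -big_nat_cond big_nat1_eq ap.
have [np | //] := ltnP n p.
by rewrite addnC mulnC modnMDl modn_small.
Qed.

Lemma logn2_modn i n : (0 < n)%N -> (logn 2 n == i) = (n %% 2 ^ i.+1 == 2 ^ i)%N.
Proof.
move=> n0; apply/eqP/eqP => [<- | e].
  have [m] := pfactor_coprime (isT : prime 2) n0.
  rewrite coprime2n; set j := logn 2 n => om ->.
  by rewrite expnS -muln_modl modn2 om mul1n.
have pos : (0 < 2 ^ i)%N by rewrite expn_gt0.
apply/eqP; rewrite eqn_leq -[(i <= _)%N]pfactor_dvdn // leqNgt -pfactor_dvdn //.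
rewrite /dvdn e -lt0n pos /= (divn_eq n (2 ^ i.+1)) e expnS mulnA.
by rewrite modnMDl modnn.
Qed.

(** The weight 1 / n^2 is at most (1 / (n - p) - 1 / n) / p, which telescopes
along the progression. *)
Lemma sum_inv_sqr_progression_le (R : realType) (p a m : nat) (V : R) :
  (a < p)%N -> p%:R < V ->
  \sum_(0 <= n < m | (n %% p == a)%N && (V <= n%:R)) (1 / n%:R ^+ 2 : R)
    <= 1 / (p%:R * (V - p%:R)).
Proof.
move=> ap pV; have p0 : 0 < p%:R :> R by rewrite ltr0n (leq_ltn_trans _ ap).
have W0 : 0 < V - p%:R by rewrite subr_gt0.
(* Truncating the denominator at V - p makes the telescoping bound hold for
   every term of the progression, also those below V, where it is 0. *)
pose g (j : nat) : R := 1 / Num.max (a%:R + p%:R * j%:R - p%:R) (V - p%:R).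
have g0 j : 0 <= g j by rewrite divr_ge0 // le_max (ltW W0) orbT.
pose F n : R := if V <= n%:R then 1 / n%:R ^+ 2 else 0.
have F0 n : 0 <= F n by rewrite /F; case: ifP => // _; rewrite divr_ge0 ?sqr_ge0.
rewrite big_mkcondr -/F.
apply: (@le_trans _ _ (\sum_(0 <= n < p * m | (n %% p == a)%N) F n)).
  rewrite [leRHS](big_cat_nat (n := m)) //=; last by rewrite leq_pmull ?(leq_ltn_trans _ ap).
  by rewrite lerDl sumr_ge0.
rewrite sum_arithmetic_progression //.
apply: (@le_trans _ _ (\sum_(0 <= j < m) (p%:R^-1 * (- g j.+1 - - g j)))).
  apply: ler_sum => j _; rewrite /F natrD natrM opprK [- g _ + g _]addrC /g -[j.+1%:R]natr1.
  set x := a%:R + p%:R * j%:R.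
  have -> : a%:R + p%:R * (j%:R + 1) - p%:R = x by rewrite /x; ring.
  have [Vx | xV] := leP V x.
    rewrite !max_l; [|lra..].
    have xp : 0 < x - p%:R by lra.
    have x0 : 0 < x by lra.
    have -> : p%:R^-1 * (1 / (x - p%:R) - 1 / x) = 1 / (x * (x - p%:R)).
      by field; rewrite !gt_eqF.
    rewrite !div1r lef_pV2 ?posrE ?mulr_gt0 ?exprn_gt0 //; nra.
  rewrite mulr_ge0 ?invr_ge0 ?(ltW p0) // subr_ge0 !div1r.
  by rewrite lef_pV2 ?posrE ?lt_max ?W0 ?orbT // ge_max !le_max lexx orbT andbT; lra.
rewrite -mulr_sumr telescope_sumr // opprK.
rewrite (_ : 1 / (p%:R * (V - p%:R)) = p%:R^-1 * (1 / (V - p%:R))); last first.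
  by field; rewrite !gt_eqF.
rewrite ler_pM2l ?invr_gt0 //.
have : g 0%N <= 1 / (V - p%:R).
  by rewrite /g !div1r lef_pV2 ?posrE ?lt_max ?W0 ?orbT // le_max lexx orbT.
have := g0 m; lra.
Qed.

(** Dual telescoping bound: 1 / n^2 is at least (1 / n - 1 / (n + p)) / p. The
progression meets every interval [U, U + p), hence U + p in the main term. *)
Lemma sum_inv_sqr_progression_ge (R : realType) (p a K : nat) (U : R) :
  (0 < a < p)%N -> 0 < U ->
  1 / (p%:R * (U + p%:R)) - 1 / (p%:R * (a + p * K)%:R) <=
  \sum_(0 <= n < p * K | (n %% p == a)%N && (U <= n%:R)) (1 / n%:R ^+ 2 : R).
Proof.
move=> /andP[a0 ap] U0; have p0 : 0 < p%:R :> R by rewrite ltr0n (leq_ltn_trans _ ap).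
have apR : a%:R < p%:R :> R by rewrite ltr_nat.
have W0 : 0 < U + p%:R by lra.
(* Truncated at U + p, so that the terms below U contribute 0 to the
   telescoping sum and the first one with n >= U at most its own share. *)
pose g (j : nat) : R := 1 / Num.max (a%:R + p%:R * j%:R) (U + p%:R).
pose F n : R := if U <= n%:R then 1 / n%:R ^+ 2 else 0.
rewrite [leRHS]big_mkcondr -/F sum_arithmetic_progression //.
apply: (@le_trans _ _ (\sum_(0 <= j < K) (p%:R^-1 * (- g j.+1 - - g j)))); last first.
  apply: ler_sum => j _; rewrite /F natrD natrM opprK [- g _ + g _]addrC /g -[j.+1%:R]natr1.
  set x := a%:R + p%:R * j%:R.
  have -> : a%:R + p%:R * (j%:R + 1) = x + p%:R by rewrite /x; ring.
  have [Ux | xU] := leP U x; last by rewrite !max_r ?subrr ?mulr0 //; lra.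
  have x0 : 0 < x by lra.
  rewrite (max_l (_ : U + p%:R <= x + p%:R)); last by lra.
  apply: (@le_trans _ _ (p%:R^-1 * (1 / x - 1 / (x + p%:R)))).
    rewrite ler_pM2l ?invr_gt0 // lerD2r !div1r lef_pV2 ?posrE ?lt_max ?x0 //.
    by rewrite le_max lexx.
  have -> : p%:R^-1 * (1 / x - 1 / (x + p%:R)) = 1 / (x * (x + p%:R)).
    by field; rewrite !gt_eqF //; lra.
  rewrite !div1r lef_pV2 ?posrE ?mulr_gt0 ?exprn_gt0 //; [nra | lra].
rewrite -mulr_sumr telescope_sumr // opprK.
have gK : g K <= 1 / (a + p * K)%:R.
  have : 0 < (a + p * K)%:R :> R by rewrite ltr0n addn_gt0 a0.
  rewrite natrD natrM => x0.
  by rewrite /g !div1r lef_pV2 ?posrE ?lt_max ?x0 // le_max lexx.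
have -> : g 0%N = 1 / (U + p%:R) by rewrite /g mulr0 addr0 max_r //; lra.
rewrite (_ : 1 / (p%:R * (U + p%:R)) = p%:R^-1 * (1 / (U + p%:R))); last first.
  by field; rewrite !gt_eqF.
have -> : 1 / (p%:R * (a + p * K)%:R) = p%:R^-1 * (1 / (a + p * K)%:R) :> R.
  by rewrite !div1r invfM.
rewrite -mulrBr ler_pM2l ?invr_gt0 //.
by have := gK; lra.
Qed.

Lemma cvgn_sum_inv_sqr (R : realType) (P : pred nat) :
  cvgn (fun m : nat => \sum_(1 <= n < m | P n) (1 / n%:R ^+ 2 : R)).
Proof.
have pos n : 0 <= 1 / n%:R ^+ 2 :> R by rewrite divr_ge0 ?sqr_ge0.
apply: nondecreasing_is_cvgn => [m m' mm' | ].
  have [m1 | m1] := leqP 1 m; last by rewrite big_geq ?sumr_ge0 // ltnW.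
  by rewrite (big_cat_nat (n := m) (p := m')) //= lerDl sumr_ge0.
exists 2 => _ [m _ <-].
pose F n : R := if (2 <= n%:R :> R) then 1 / n%:R ^+ 2 else 0.
apply: (@le_trans _ _ (\sum_(0 <= n < m) ((if n == 1%N then 1 else 0) + F n))).
  rewrite (@big_nat_widenl _ _ _ 1 0) // big_mkcond /=; apply: ler_sum => n _.
  rewrite /F ler_nat; case: n => [|[|n]] /=; rewrite ?andbF ?addr0 //.
    by rewrite expr1n divr1; case: ifP.
  by rewrite add0r; case: ifP.
rewrite big_split /= -big_mkcond big_nat1_eq.
rewrite (_ : 2 = 1 + 1 / (1%:R * (2 - 1%:R))); last by field.
apply: lerD; first by case: ifP.
have := @sum_inv_sqr_progression_le R 1 0 m 2 isT.
rewrite big_mkcondr; under eq_bigl do rewrite modn1 eqxx.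
by apply; lra.
Qed.

(** * Mass on one side of a point *)

Lemma positive_values_bounded_below (R : realType) (psi : nat -> R) (N : nat) :
  exists2 d : R, 0 < d & forall n, (n < N)%N -> 0 < psi n -> d <= psi n.
Proof.
elim: N => [|N [d d0 dP]]; first by exists 1.
have [p0 | p0] := leP (psi N) 0.
  by exists d => // n; rewrite ltnS leq_eqVlt => /predU1P[-> | /dP //]; lra.
exists (Num.min d (psi N)); first by rewrite lt_min d0.
move=> n; rewrite ltnS leq_eqVlt ge_min => /predU1P[-> | /dP H /H ->//].
by rewrite lexx orbT.
Qed.

(** The weights 1 / n^2 at the positive distances [psi n] have mass c h + O(h^2)
within distance h. The predicate [Q] may or may not include the n at distance
exactly h, because the increment of G to the right of a point omits an atom
there and the increment to its left counts it. *)
Definition linear_mass (R : realType) (psi : nat -> R) (c : R) : Prop :=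
  exists C d : R, 0 < d /\ forall (h L : R) (Q : pred nat),
    0 < h < d ->
    (forall n, (0 < n)%N -> 0 < psi n < h -> Q n) ->
    (forall n, (0 < n)%N -> Q n -> 0 < psi n <= h) ->
    (fun m : nat => \sum_(1 <= n < m | Q n) (1 / n%:R ^+ 2 : R)) @ \oo --> L ->
    `|L - c * h| <= C * h ^+ 2.

(** Within distance h lie all n of the progression with n >= U = B / h, none with
n < U - p, and among the other n at most those with n >= 1 / h^2. The telescoping
bounds compare the two sums with 1 / (p U), which is the linear term. *)
Lemma one_sided_mass (R : realType) (i : nat) (B : R) (psi : nat -> R)
    (p := (2 ^ i.+1)%:R : R) :
  0 < B ->
  (\forall n \near \oo, logn 2 n = i -> B / (n%:R + p) < psi n < B / n%:R) ->
  (\forall n \near \oo, logn 2 n <> i -> 0 < psi n -> 1 <= psi n ^+ 2 * n%:R) ->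
  linear_mass R psi (1 / (p * B)).
Proof.
move=> B0 shell sparse.
have [N _ NP] : \forall n \near \oo,
    (logn 2 n = i -> B / (n%:R + p) < psi n < B / n%:R) /\
    (logn 2 n <> i -> 0 < psi n -> 1 <= psi n ^+ 2 * n%:R).
  by apply: filterS2 shell sparse => n; split.
have p2 : 2 <= p.
  by rewrite /p expnS natrM -[leLHS]mulr1 ler_pM2l // ler1n expn_gt0.
have p0 : 0 < p by lra.
pose c := 1 / (p * B).
have classE n : (0 < n)%N -> (logn 2 n == i) = (n %% 2 ^ i.+1 == 2 ^ i)%N.
  exact: logn2_modn.
have residue : (0 < 2 ^ i < 2 ^ i.+1)%N by rewrite expn_gt0 ltn_exp2l /=.
have [d d0 dP] := positive_values_bounded_below R psi N.
exists (4 / B ^+ 2 + 2).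
exists (Num.min (Num.min d (B / N.+1%:R)) (Num.min (1 / 2) (B / (4 * p)))).
split; first by rewrite !lt_min d0 !divr_gt0 ?mulr_gt0.
move=> h L Q; rewrite !lt_min => /and3P[h0 /andP[hd hN] /andP[h2 hB]] Qlo Qhi sL.
have ph0 : 0 < p * h by rewrite mulr_gt0.
have {}hN : N.+1%:R * h < B by move: hN; rewrite ltr_pdivlMr // mulrC.
have {}hB : 4 * p * h < B by move: hB; rewrite ltr_pdivlMr ?mulr_gt0 // mulrC.
pose U := B / h.
have U0 : 0 < U by rewrite divr_gt0.
have U4 : 4 * p < U by rewrite ltr_pdivlMr.
have UN : N.+1%:R < U by rewrite ltr_pdivlMr.
have V1 : 1%:R < (h ^+ 2)^-1 by rewrite invf_gt1 ?exprn_gt0 // expr_lt1 //; lra.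
have QN n : (0 < n)%N -> Q n -> (N <= n)%N.
  move=> n0 /(Qhi n n0)/andP[ps0 psh]; rewrite leqNgt; apply/negP => nN.
  by have := dP n nN ps0; lra.
have term0 n : 0 <= 1 / n%:R ^+ 2 :> R by rewrite divr_ge0 ?sqr_ge0.
rewrite -/c ler_norml; apply/andP; split.
(* Lower bound: the part of the progression from U up to 2^i + p K, with K so
   large that the missing tail is below h^2. *)
- have [K] : exists K : nat, (h ^+ 2)^-1 < K%:R.
    by exists (Num.bound (h ^+ 2)^-1); rewrite archi_boundP // invr_ge0 sqr_ge0.
  move=> hK; pose x : R := (2 ^ i + 2 ^ i.+1 * K)%:R.
  have xK : K%:R <= x.
    by rewrite ler_nat; apply: leq_trans (leq_addl _ _); rewrite leq_pmull ?expn_gt0.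
  have x0 : 0 < x by apply: lt_le_trans xK; apply: lt_trans hK; rewrite invr_gt0 exprn_gt0.
  have xh : 1 / (p * x) <= h ^+ 2.
    rewrite -[leRHS]invrK div1r lef_pV2 ?posrE ?mulr_gt0 ?invr_gt0 ?exprn_gt0 //.
    by rewrite (le_trans (ltW hK)) // (le_trans xK) // ler_peMl ?(ltW x0) //; lra.
  have := sum_inv_sqr_progression_ge R _ _ K U residue U0.
  rewrite -/p -/x => lo.
  have LK : \sum_(1 <= n < 2 ^ i.+1 * K | Q n) (1 / n%:R ^+ 2) <= L.
    rewrite -(cvg_lim _ sL) //; apply: nondecreasing_cvgn_le.
      move=> m m' mm'; have [m1 | m1] := leqP 1 m; last by rewrite big_geq ?sumr_ge0 // ltnW.
      by rewrite (big_cat_nat (n := m) (p := m')) //= lerDl sumr_ge0.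
    by apply/cvg_ex; exists L.
  have : 1 / (p * (U + p)) - 1 / (p * x) <= L.
    apply: le_trans LK; apply: (le_trans lo).
    rewrite [leRHS](@big_nat_widenl _ _ _ 1 0) // [leLHS]big_mkcond [leRHS]big_mkcond.
    apply: ler_sum => n _ /=; case: ifP => [/andP[cl Un] | _]; last by case: ifP.
    have n0 : (0 < n)%N by rewrite -(ltr_nat R); lra.
    have n0' : 0 < n%:R :> R by rewrite ltr0n.
    have nN : (N <= n)%N by rewrite -(ler_nat R); move: UN; rewrite -natr1; lra.
    have [inshell _] := NP n nN.
    have /andP[lo1 hi1] : B / (n%:R + p) < psi n < B / n%:R.
      by apply/inshell/eqP; rewrite classE.
    have ps0 : 0 < psi n by apply: le_lt_trans lo1; rewrite divr_ge0 ?addr_ge0 // ltW.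
    have psh : psi n < h.
      apply: lt_le_trans hi1 _; rewrite ler_pdivrMr //.
      by move: Un; rewrite ler_pdivrMr // mulrC.
    by rewrite Qlo ?n0 ?ps0.
  have : c * h - 1 / (p * (U + p)) = h ^+ 2 / (B * (B + p * h)).
    by rewrite /U /c; field; rewrite ?gt_eqF //; lra.
  have : h ^+ 2 / (B * (B + p * h)) <= h ^+ 2 / B ^+ 2.
    rewrite ler_pM2l ?exprn_gt0 // lef_pV2 ?posrE ?mulr_gt0 ?exprn_gt0 //; last by lra.
    by rewrite expr2 ler_pM2l //; lra.
  rewrite mulrDl => ? ? ?.
  have : h ^+ 2 / B ^+ 2 <= 4 / B ^+ 2 * h ^+ 2.
    have : 0 <= h ^+ 2 / B ^+ 2 by rewrite divr_ge0 ?sqr_ge0.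
    lra.
  have := sqr_ge0 h; lra.
(* Upper bound: the progression from U - p on, and all integers from 1 / h^2
   on. *)
- have -> : L = limn (fun m : nat => \sum_(1 <= n < m | Q n) (1 / n%:R ^+ 2 : R)).
    by rewrite (cvg_lim _ sL).
  rewrite lerBlDr; apply: limr_le; first by apply/cvg_ex; exists L.
  near=> m.
  apply: (@le_trans _ _ (1 / (p * (U - p - p)) + 1 / (1%:R * ((h ^+ 2)^-1 - 1%:R)))).
    have pV : (2 ^ i.+1)%:R < U - p by rewrite -/p; lra.
    have /andP[_ rp] := residue.
    apply: le_trans (lerD (sum_inv_sqr_progression_le R _ _ m _ rp pV)
      (sum_inv_sqr_progression_le R 1 0 m _ isT V1)).
    rewrite [leLHS](@big_nat_widenl _ _ _ 1 0) // [leLHS]big_mkcond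
      [X in _ <= X + _]big_mkcond [X in _ <= _ + X]big_mkcond -big_split /=.
    apply: ler_sum => n _; rewrite modn1 eqxx /=; case: ifP => [/andP[Qn n0] | _]; last first.
      by rewrite addr_ge0 //; case: ifP.
    have n0' : 0 < n%:R :> R by rewrite ltr0n.
    have [cl0 cl1] := NP n (QN n n0 Qn); have /andP[ps0 psh] := Qhi n n0 Qn.
    have [e | ne] := eqVneq (logn 2 n) i.
      have /andP[lo1 _] := cl0 e; rewrite -classE // e eqxx /= ifT.
        by rewrite lerDl; case: ifP.
      have : B / (n%:R + p) < h by apply: lt_le_trans psh.
      by rewrite ltr_pdivrMr ?addr_gt0 // mulrC -ltr_pdivrMr // -/U; lra.
    rewrite [X in _ + X]ifT; first by rewrite lerDr; case: ifP.
    have sq := cl1 (elimN eqP ne) ps0.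
    rewrite -div1r ler_pdivrMr ?exprn_gt0 // (le_trans sq) // mulrC ler_pM2l //.
    by rewrite lerXn2r ?nnegrE // ltW.
  have -> : 1 / (p * (U - p - p)) = c * h + 2 * h ^+ 2 / (B * (B - 2 * p * h)).
    by rewrite /U /c; field; rewrite ?gt_eqF //; lra.
  have : 2 * h ^+ 2 / (B * (B - 2 * p * h)) <= 4 / B ^+ 2 * h ^+ 2.
    rewrite ler_pdivrMr; last by rewrite mulr_gt0 //; lra.
    have -> : 4 / B ^+ 2 * h ^+ 2 * (B * (B - 2 * p * h)) =
        4 * h ^+ 2 * ((B - 2 * p * h) / B).
      by field; rewrite gt_eqF.
    have half : 1 / 2 <= (B - 2 * p * h) / B by rewrite ler_pdivlMr //; lra.
    have := ler_wpM2l (mulr_ge0 (ler0n R 4) (sqr_ge0 h)) half; lra.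
  have : 1 / (1%:R * ((h ^+ 2)^-1 - 1%:R)) <= 2 * h ^+ 2.
    rewrite ler_pdivrMr; last by lra.
    have -> : 2 * h ^+ 2 * (1%:R * ((h ^+ 2)^-1 - 1%:R)) = 2 - 2 * h ^+ 2.
      by field; rewrite gt_eqF.
    have := ler_wpM2l (ltW h0) (ltW h2); rewrite -expr2; lra.
  lra.
Unshelve. all: by end_near.
Qed.

(** * From masses to the derivative of G *)

Lemma G_increment (R : realType) (phi : nat -> rat) (x y : R) : x <= y ->
  (fun m : nat => \sum_(1 <= n < m | x <= ratr (phi n) < y) (1 / n%:R ^+ 2 : R))
    @ \oo --> @G R phi y - @G R phi x.
Proof.
move=> xy.
have Gz z := cvgn_sum_inv_sqr R (fun n => ratr (phi n) < z).
rewrite (_ : (fun m : nat => _) = (fun m : nat =>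
    \sum_(1 <= n < m | ratr (phi n) < y) (1 / n%:R ^+ 2 : R) -
    \sum_(1 <= n < m | ratr (phi n) < x) (1 / n%:R ^+ 2 : R))).
  by apply: cvgB; apply: Gz.
apply/funext => m; rewrite big_mkcond [X in _ = X - _]big_mkcond [X in _ = _ - X]big_mkcond.
rewrite -sumrB; apply: eq_bigr => n _.
have [nx | xn] := ltP (ratr (phi n)) x; first by rewrite (lt_le_trans nx xy) /= subrr.
by rewrite /=; case: ifP; rewrite subr0.
Qed.

Lemma linear_mass_derive (R : realType) (phi : nat -> rat) (x c : R) :
  (forall n, (0 < n)%N -> ratr (phi n) != x) ->
  linear_mass R (fun n => ratr (phi n) - x) c ->
  linear_mass R (fun n => x - ratr (phi n)) c ->
  derivable (@G R phi) x 1 /\ derive1 (@G R phi) x = c.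
Proof.
move=> phix [C1 [d1 [d10 right]]] [C2 [d2 [d20 left]]].
have bound h : 0 < `|h| < Num.min d1 d2 ->
    `|@G R phi (h + x) - @G R phi x - c * h| <= (`|C1| + `|C2|) * h ^+ 2.
  rewrite lt_min normr_gt0 => /and3P[h0 hd1 hd2].
  have C10 := normr_ge0 C1; have C20 := normr_ge0 C2.
  have C1le := ler_norm C1; have C2le := ler_norm C2.
  have [hneg | hpos | h00] := ltgtP h 0; last by rewrite h00 eqxx in h0.
  - rewrite (ltr0_norm hneg) in hd2.
    have hx : h + x <= x by lra.
    have hd : 0 < - h < d2 by lra.
    have := left (- h) _ _ hd _ _ (G_increment R phi _ _ hx).
    rewrite sqrrN -normrN => incr.
    rewrite (_ : _ - c * h = - (@G R phi x - @G R phi (h + x) - c * - h)); last by ring.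
    apply: (le_trans (incr _ _)).
    + by move=> n _ /andP[? ?]; lra.
    + by move=> n _ /andP[? ?]; lra.
    + by rewrite ler_wpM2r ?sqr_ge0 //; lra.
  - rewrite (gtr0_norm hpos) in hd1.
    have xh : x <= h + x by lra.
    have hd : 0 < h < d1 by lra.
    apply: le_trans (right h _ _ hd _ _ (G_increment R phi _ _ xh)) _.
    + by move=> n _ /andP[? ?]; lra.
    + by move=> n n0 /andP[xn ?]; rewrite subr_gt0 lt_neqAle eq_sym phix // xn /=; lra.
    + by rewrite ler_wpM2r ?sqr_ge0 //; lra.
have lim_c : h^-1 *: (@G R phi (h + x) - @G R phi x) @[h --> 0^'] --> c.
  apply/cvgrPdist_le => e e0.
  pose C := `|C1| + `|C2| + 1.
  have C0 : 0 < C by rewrite ltr_wpDl ?addr_ge0.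
  near=> h.
  have h0 : h != 0 by near: h; exact: nbhs_dnbhs_neq.
  have hd : `|h| < Num.min d1 d2 by near: h; apply: dnbhs0_lt; rewrite lt_min d10.
  have he : `|h| < e / C by near: h; apply: dnbhs0_lt; rewrite divr_gt0.
  have hn : 0 < `|h| by rewrite normr_gt0.
  rewrite distrC -(ler_pM2r hn) -normrM.
  rewrite [X in `|X|](_ : _ = @G R phi (h + x) - @G R phi x - c * h); last first.
    by rewrite /GRing.scale /=; field.
  apply: (le_trans (bound h _)); first by rewrite hn hd.
  rewrite -(real_normK (num_real h)) expr2 mulrA ler_pM2r //.
  move: he; rewrite ltr_pdivlMr // mulrC /C; nra.
split.
- rewrite /derivable; apply/cvg_ex; exists c.
  rewrite (_ : (fun h : R => _) = (fun h : R => h^-1 *: (@G R phi (h + x) - @G R phi x))) //.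
  by apply/funext => h; rewrite /= /GRing.scale /= mulr1.
- exact: cvg_lim.
Unshelve. all: by end_near.
Qed.

(** * The placement of integers at rationals *)

(** The points where n may be put to serve xi_k, with k half the 2-adic valuation
of n; its parity chooses the side (even: right, odd: left). *)
Definition shell (R : realType) (xi c : nat -> R) (n : nat) (x : R) : bool :=
  let i := logn 2 n in let p : R := (2 ^ i.+1)%:R in let B := 1 / (p * c i./2) in
  B / (n%:R + p) < (-1) ^+ odd i * (x - xi i./2) < B / n%:R.

(** Distance at least n^(-1/2): at most the n >= 1 / h^2 can then lie within h of
xi_j, and their total weight is negligible compared with h. *)
Definition far (R : realType) (xi : nat -> R) (n : nat) (x : R) (j : nat) : bool :=
  1 <= (x - xi j) ^+ 2 * n%:R.

(** The integers that are actually put into their shell: the shell must be small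
enough to stay [far] from the points treated before, which fails for only
finitely many n of each progression with k > 0. The progressions with k = 0 serve
no point and leave a supply of spare integers. *)
Definition filling (R : realType) (xi c : nat -> R) (n : nat) : Prop :=
  (0 < (logn 2 n)./2)%N /\
  forall x, shell R xi c n x ->
    forall j, (0 < j < (logn 2 n)./2)%N -> far R xi n x j.

(** Integers that do not fill a shell may be used at q if they are [far] from
enough of the xi_j. The number N of points avoided need only tend to infinity
with n or with the code of q: either way, a fixed point is avoided by all but
finitely many of the pairs (n, q) of a bijection. *)
Definition admissible (R : realType) (xi c : nat -> R) (n : nat) (q : rat) : Prop :=
  (filling R xi c n /\ shell R xi c n (ratr q)) \/
  (~ filling R xi c n /\ exists N : nat, (n <= N \/ pickle q <= N)%N /\
    forall j, (0 < j < N)%N -> far R xi n (ratr q) j).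

Lemma eventually_all_below (P : nat -> nat -> Prop) (N : nat) :
  (forall j, (j < N)%N -> \forall n \near \oo, P j n) ->
  \forall n \near \oo, forall j, (j < N)%N -> P j n.
Proof.
move=> PN; have : \forall n \near \oo, forall j : 'I_N, P j n.
  by apply: filter_forall => j; apply: PN.
by apply: filterS => n Pn j jN; apply: (Pn (Ordinal jN)).
Qed.

Lemma eventually_mul_ge1 (R : realType) (y : R) : 0 < y ->
  \forall n \near \oo, 1 <= y * n%:R.
Proof.
move=> y0; near=> n; rewrite mulrC -ler_pdivrMr //.
near: n; exact: nbhs_infty_ger.
Unshelve. all: by end_near. Qed.

(** The shells shrink to xi_k at the rate 1 / n, so they end up at a positive
distance from any other point, while [far] asks only for n^(-1/2). *)
Lemma shell_far (R : realType) (xi c : nat -> R) (i j : nat) :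
  0 < c i./2 -> xi j != xi i./2 ->
  \forall n \near \oo, logn 2 n = i ->
    forall x, shell R xi c n x -> far R xi n x j.
Proof.
move=> c0 ne; pose D := `|xi i./2 - xi j|.
have D0 : 0 < D by rewrite normr_gt0 subr_eq0 eq_sym.
pose B := 1 / ((2 ^ i.+1)%:R * c i./2).
have p0 : 0 < (2 ^ i.+1)%:R :> R by rewrite ltr0n expn_gt0.
have B0 : 0 < B by rewrite divr_gt0 ?mulr_gt0.
near=> n => e x; rewrite /shell /far e -/B => /andP[lo hi].
have n1 : 1 <= D / (2 * B) * n%:R.
  by near: n; apply: eventually_mul_ge1; rewrite divr_gt0 // mulr_gt0.
have n2 : 1 <= D ^+ 2 / 4 * n%:R.
  by near: n; apply: eventually_mul_ge1; rewrite divr_gt0 ?exprn_gt0.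
have n0 : 0 < n%:R :> R.
  rewrite ltr0n; near: n; exact: nbhs_infty_gt.
have xk : `|x - xi i./2| <= D / 2.
  have -> : `|x - xi i./2| = `|(-1) ^+ odd i * (x - xi i./2)|.
    by rewrite normrM normr_sign mul1r.
  rewrite gtr0_norm; last first.
    by apply: le_lt_trans lo; rewrite divr_ge0 ?addr_ge0 // ltW.
  apply: le_trans (ltW hi) _; rewrite ler_pdivrMr //.
  have -> : D / 2 * n%:R = B * (D / (2 * B) * n%:R) by field; rewrite gt_eqF.
  by rewrite ler_peMr // ltW.
have xj : D / 2 <= `|x - xi j|.
  have := ler_distD x (xi i./2) (xi j); rewrite -/D (distrC (xi i./2)); lra.
apply: (le_trans n2); rewrite ler_pM2r // -(real_normK (num_real (x - xi j))).
have -> : D ^+ 2 / 4 = (D / 2) ^+ 2 by field.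
by rewrite lerXn2r ?nnegrE // divr_ge0 // ltW.
Unshelve. all: by end_near. Qed.

Lemma rat_between_notin (R : realType) (s : seq rat) (a b : R) :
  a < b -> exists q : rat, [/\ q \notin s, a < ratr q & ratr q < b].
Proof.
elim: s a b => [|x s IHs] a b ab.
  by have [q] := rat_in_itvoo ab; rewrite in_itv => /andP[]; exists q.
have [xle | xgt] := leP (ratr x) ((a + b) / 2).
  have [|q [qs aq qb]] := IHs ((a + b) / 2) b; first by lra.
  exists q; split=> //; last by lra.
  rewrite inE negb_or qs andbT; apply/eqP => e; rewrite e in aq; lra.
have [|q [qs aq qb]] := IHs a ((a + b) / 2); first by lra.
exists q; split=> //; last by lra.
rewrite inE negb_or qs andbT; apply/eqP => e; rewrite e in qb; lra.
Qed.

(** An integer that does not fill a shell can be put to the right of all the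
points with index below n. *)
Lemma admissible_left (R : realType) (xi c : nat -> R) :
  (forall k, (0 < k)%N -> 0 < c k) ->
  forall n (s : seq rat), (0 < n)%N ->
  exists2 q, q \notin s & admissible R xi c n q.
Proof.
move=> c0 n s n0; have n0' : 0 < n%:R :> R by rewrite ltr0n.
have [fn | nf] := pselect (filling R xi c n).
  pose i := logn 2 n; pose p : R := (2 ^ i.+1)%:R; pose B := 1 / (p * c i./2).
  have p0 : 0 < p by rewrite ltr0n expn_gt0.
  have B0 : 0 < B by have [k0 _] := fn; rewrite divr_gt0 // mulr_gt0 // c0.
  have lt_radii : B / (n%:R + p) < B / n%:R.
    by rewrite ltr_pM2l // ltf_pV2 ?posrE ?addr_gt0 // ltrDl.
  suff [q [qs sq]] : exists q : rat, q \notin s /\ shell R xi c n (ratr q).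
    by exists q => //; left.
  rewrite /shell -/i -/p -/B; case: (odd i) => /=.
    have [|q [qs lo hi]] := rat_between_notin R s
      (xi i./2 - B / n%:R) (xi i./2 - B / (n%:R + p)).
      by rewrite ltrD2l ltrN2.
    by exists q; split=> //; rewrite expr1; apply/andP; split; lra.
  have [|q [qs lo hi]] := rat_between_notin R s
    (xi i./2 + B / (n%:R + p)) (xi i./2 + B / n%:R).
    by rewrite ltrD2l.
  by exists q; split=> //; rewrite expr0; apply/andP; split; lra.
have [M MP] : exists M : R, forall j, (j < n)%N -> xi j <= M.
  exists (\sum_(j < n) `|xi j|) => j jn.
  by rewrite (bigD1 (Ordinal jn)) //= (le_trans (ler_norm _)) // lerDl sumr_ge0.
have [|q [qs lo hi]] := rat_between_notin R s (M + 1) (M + 2); first by lra.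
exists q => //; right; split=> //; exists n; split; first by left.
move=> j /andP[_ jn]; have := MP j jn; rewrite /far => xM.
have n1 : 1 <= n%:R :> R by rewrite ler1n.
have : 1 <= (ratr q - xi j) ^+ 2 by rewrite expr_ge1 //; lra.
by move=> d1; apply: mulr_ege1.
Qed.

(** Odd integers never fill a shell, and since q is none of the irrational xi_j,
every large odd n is [far] from the finitely many xi_j with j below the code
of q. *)
Lemma admissible_right (R : realType) (xi c : nat -> R) :
  (forall k, (0 < k)%N -> irrational (xi k)) ->
  forall (q : rat) (s : seq nat),
  exists n, [/\ n \notin s, (0 < n)%N & admissible R xi c n q].
Proof.
move=> irr q s.
have : \forall n \near \oo, forall j, (j < pickle q)%N -> (0 < j)%N ->
    far R xi n (ratr q) j.
  apply: eventually_all_below => j _; have [-> | j0] := posnP j; first exact: nearW.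
  have : 0 < (ratr q - xi j) ^+ 2.
    rewrite exprn_even_gt0 //= subr_eq0; apply/eqP => e.
    by apply: (irr j j0); exists q.
  by move=> /eventually_mul_ge1; apply: filterS.
move=> [N _ NP]; pose n := (N + \sum_(m <- s) m).*2.+1; exists n; split=> //.
  apply/negP => ns; have : (n <= \sum_(m <- s) m)%N.
    by rewrite (big_rem n) //= leq_addr.
  by rewrite /n; lia.
right; have logn0 : logn 2 n = 0%N.
  by apply/eqP; rewrite lognE /= dvdn2 /= odd_double.
split; first by rewrite /filling logn0 => -[].
exists (pickle q); split; first by right.
move=> j /andP[j0 jq]; apply: NP => //=; rewrite /n; lia.
Qed.

(** The exceptions at xi_k are finite in number for each possible cause: shells of
the finitely many earlier points, integers n <= k, and rationals with code at
most k. Shells of later points avoid xi_k by the definition of [filling]. *)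
Lemma admissible_dichotomy (R : realType) (xi c : nat -> R) (phi : nat -> rat) (k : nat) :
  (forall j, (0 < j)%N -> 0 < c j) ->
  (forall j, (0 < j)%N -> xi k = xi j -> k = j) ->
  (forall m n, (0 < m)%N -> (0 < n)%N -> phi m = phi n -> m = n) ->
  (forall n, (0 < n)%N -> admissible R xi c n (phi n)) ->
  (0 < k)%N ->
  \forall n \near \oo,
    ((logn 2 n)./2 = k /\ shell R xi c n (ratr (phi n))) \/
    far R xi n (ratr (phi n)) k.
Proof.
move=> c0 inj phi_inj adm k0.
have shells : \forall n \near \oo, forall i, (i < k.*2)%N -> (0 < i./2)%N ->
    logn 2 n = i -> forall x, shell R xi c n x -> far R xi n x k.
  apply: eventually_all_below => i ik.
  have [_ | i0] := posnP i./2; first exact: nearW.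
  suff : \forall n \near \oo, logn 2 n = i ->
    forall x, shell R xi c n x -> far R xi n x k by apply: filterS => n.
  apply: shell_far; first exact: c0.
  by apply/eqP => /(inj _ i0); lia.
have codes : \forall n \near \oo, forall l, (l < k.+1)%N -> pickle (phi n) <> l.
  apply: eventually_all_below => l _.
  have [[m m0 e] | none] := pselect (exists2 m, (0 < m)%N & pickle (phi m) = l).
    near=> n => e'; have mn : (m < n)%N by near: n; exact: nbhs_infty_gt.
    have := phi_inj m n m0 (leq_ltn_trans (leq0n m) mn).
    have -> : phi m = phi n by apply: (pcan_inj pickleK); rewrite e e'.
    by move=> /(_ erefl) mn'; rewrite mn' ltnn in mn.
  near=> n => e; apply: none; exists n => //; near: n; exact: nbhs_infty_gt.
near=> n.
have kn : (k < n)%N by near: n; exact: nbhs_infty_gt.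
have [[[i0 below] sh] | [_ [N [nN farN]]]] := adm n (leq_ltn_trans (leq0n k) kn).
  have [ik | ki | e] := ltngtP (logn 2 n)./2 k.
  - right; move: sh; apply: (near shells n _ (logn 2 n)) => //; lia.
  - by right; apply: below => //; rewrite k0.
  - by left.
right; apply: farN; rewrite k0 /=; case: nN => nN; first exact: leq_trans nN.
have codesn := near codes n _.
have [//|Nk] := ltnP k N.
by case: (codesn _ (pickle (phi n))) => //; rewrite ltnS (leq_trans nN).
Unshelve. all: by end_near. Qed.

Lemma eventually_filling (R : realType) (xi c : nat -> R) (i : nat) :
  (0 < i./2)%N -> 0 < c i./2 ->
  (forall j, (0 < j)%N -> xi j = xi i./2 -> j = i./2) ->
  \forall n \near \oo, logn 2 n = i -> filling R xi c n.
Proof.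
move=> k0 c0 inj.
have : \forall n \near \oo, forall j, (j < i./2)%N -> (0 < j)%N ->
    logn 2 n = i -> forall x, shell R xi c n x -> far R xi n x j.
  apply: eventually_all_below => j ji.
  have [_ | j0] := posnP j; first exact: nearW.
  have : \forall n \near \oo, logn 2 n = i ->
    forall x, shell R xi c n x -> far R xi n x j.
    by apply: shell_far => //; apply/eqP => /(inj _ j0) e; rewrite e ltnn in ji.
  by apply: filterS => n.
apply: filterS => n farn e; rewrite /filling e; split=> // x sh j /andP[j0 ji].
exact: farn.
Qed.

Lemma admissible_linear_mass (R : realType) (xi c : nat -> R) (phi : nat -> rat)
    (k : nat) (b : bool) :
  (forall j, (0 < j)%N -> 0 < c j) ->
  (forall j, (0 < j)%N -> xi j = xi k -> j = k) ->
  (forall m n, (0 < m)%N -> (0 < n)%N -> phi m = phi n -> m = n) ->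
  (forall n, (0 < n)%N -> admissible R xi c n (phi n)) ->
  (0 < k)%N ->
  linear_mass R (fun n => (-1) ^+ b * (ratr (phi n) - xi k)) (c k).
Proof.
move=> c0 inj phi_inj adm k0; pose i := (b + k.*2)%N.
have ik : i./2 = k by rewrite half_bit_double.
have ib : odd i = b by rewrite oddD odd_double addbF; case: (b).
pose p : R := (2 ^ i.+1)%:R; pose B := 1 / (p * c k).
have p0 : 0 < p by rewrite ltr0n expn_gt0.
have ck0 := c0 k k0.
have B0 : 0 < B by rewrite divr_gt0 ?mulr_gt0.
have -> : c k = 1 / (p * B) by rewrite /B; field; rewrite !gt_eqF.
apply: one_sided_mass => //.
  have : \forall n \near \oo, logn 2 n = i -> filling R xi c n.
    by apply: eventually_filling; rewrite ik //; apply: inj.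
  apply: filterS2 (nbhs_infty_gt 0) => n n0 fill e.
  have [[_] | [/(_ (fill e)) //]] := adm n n0.
  by rewrite /shell e ik ib.
have inj' j : (0 < j)%N -> xi k = xi j -> k = j by move=> j0 e; rewrite (inj j).
have := admissible_dichotomy R xi c phi k c0 inj' phi_inj adm k0.
apply: filterS => n [[half_n] | ].
- rewrite /shell half_n => /andP[lo _] ne ps0; exfalso.
  have n0 : 0 <= n%:R :> R by [].
  have lo0 : 0 < (-1) ^+ odd (logn 2 n) * (ratr (phi n) - xi k).
    by apply: le_lt_trans lo; rewrite !divr_ge0 ?mulr_ge0 ?addr_ge0 // ltW.
  have : odd (logn 2 n) != b.
    apply/eqP => e; apply: ne.
    by rewrite -(odd_double_half (logn 2 n)) half_n e.
  move: lo0 ps0; case: (odd _); case: (b) => //=; rewrite expr0 expr1; lra.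
- by rewrite /far exprMn sqrr_sign mul1r.
Qed.

(** * The theorem *)

Theorem mainTheorem1 (R : realType) (xi c : nat -> R)
  (xi_irrational : forall k : nat, posnats k -> irrational (xi k))
  (xi_distinct : set_inj posnats xi)
  (c_pos : forall k : nat, posnats k -> 0 < c k) :
  exists phi : nat -> rat,
    set_bij posnats [set: rat] phi /\
    forall k : nat, posnats k ->
      derivable (@G R phi) (xi k) 1 /\ derive1 (@G R phi) (xi k) = c k.
Proof.
have [|q s|f [f_inj f_surj f_adm]] :=
    back_and_forth rat (fun n => admissible R xi c n.+1).
- by move=> n s; apply: admissible_left.
- have [[|n] [ns //]] := admissible_right R xi c xi_irrational q (map S s).
  by exists n => //; apply: contraNN ns => /(map_f S).
exists (fun n => f n.-1); split.
  split=> // [m n | q _].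
    rewrite !inE => m0 n0 /f_inj e.
    by rewrite -(prednK m0) -(prednK n0) e.
  by have [n <-] := f_surj q; exists n.+1.
move=> k k0.
have mass (b : bool) : linear_mass R (fun n => (-1) ^+ b * (ratr (f n.-1) - xi k)) (c k).
  apply: (admissible_linear_mass R xi c (fun n => f n.-1)) => //.
  - by move=> j j0; apply: xi_distinct; rewrite inE.
  - by move=> m n m0 n0 /f_inj e; rewrite -(prednK m0) -(prednK n0) e.
  - by move=> n n0; have := f_adm n.-1; rewrite prednK.
apply: linear_mass_derive.
- by move=> n _; apply/eqP => e; apply: (xi_irrational k k0); exists (f n.-1).
- by have := mass false; congr linear_mass; apply/funext => n; rewrite expr0 mul1r.
- have := mass true; congr linear_mass; apply/funext => n.
  by rewrite expr1 mulN1r opprB.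
Qed.
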